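(* Let $g,h\in\mathbb R$ be such that $\mathcal A_{g,h}$ is a partially alternative division algebra, and let $\mathrm{Aut}(\mathcal A_{g,h})$ denote its group of algebra automorphisms. Then every automorphism in $\mathrm{Aut}(\mathcal A_{g,h})$ is inner. Moreover: (1) if $h=0$, then $\mathcal A_{g,h}$ is isomorphic to the real quaternion algebra, and $\mathrm{Aut}(\mathcal A_{g,h})\cong SO(3)$; (2) if $h\neq 0$, then $\mathrm{Aut}(\mathcal A_{g,h})\cong\mathbb Z_2$, and in this case the only nontrivial automorphism is a reflection.
   Context: For $g,h\in\mathbb R$, $\mathcal A_{g,h}$ is the four-dimensional real (nonassociative) algebra with basis $\{1,i,j,k\}$ and bilinear product given by the table (entry in row $x$ and column $y$ is $xy$): $$\begin{array}{c|cccc} & 1 & i & j & k\\ \hline 1 & 1 & i & j & k\\ i & i & -1 & -k & j\\ j & j & k & -1 & -i\\ k & k & -j & i & g1+hi\end{array}$$ A finite-dimensional real algebra is a division algebra if left and right multiplications by every nonzero element are bijective. For a unital real algebra $\mathcal A$, an imaginary unit is an element $q$ with $q^2=-1$, and $\mathcal I_{\mathcal A}$ is the set of imaginary units. With $(a,b,c)=(ab)c-a(bc)$, $\mathcal A$ is partially alternative if $\mathcal I_{\mathcal A}\neq\emptyset$ and $(x,x,y)=(x,y,x)=(y,x,x)=0$ for all $x\in\mathcal I_{\mathcal A}$ and $y\in\mathcal A$. A reflection is a nontrivial automorphism of order $2$. An automorphism $f$ is inner if there are $u,u^{-1}\in\mathcal A$ with $uu^{-1}=u^{-1}u=1$ and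 $f(x)=(ux)u^{-1}=u(xu^{-1})$ for all $x\in\mathcal A$. *)

(* Defs.v *)
From HB Require Import structures.
From mathcomp Require Import all_boot all_fingroup all_algebra.
From mathcomp Require Import boolp reals.

Set Implicit Arguments.
Unset Strict Implicit.
Unset Printing Implicit Defensive.

Import GRing.Theory.
Local Open Scope ring_scope.

(* Finite-dimensional unital algebras, not assumed associative (the algebra
   structures of MathComp are all associative). *)
Record naAlgebra (F : fieldType) := NaAlgebra {
  na_sort :> vectType F;
  na_mul : {bilinear na_sort -> na_sort -> na_sort};
  na_one : na_sort;
  na_mul1l : left_id na_one na_mul;
  na_mul1r : right_id na_one na_mul }.

Notation "x ** y" := (na_mul _ x y) (at level 40, left associativity) : ring_scope.

Section Notions.
Variables (F : fieldType) (A : naAlgebra F).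
Implicit Types x y z q u v : A.

Definition division_algebra : Prop :=
  forall x, x != 0 -> bijective (fun y => x ** y) /\ bijective (fun y => y ** x).

Definition imaginary_unit q : Prop := q ** q = - na_one A.

Definition associator x y z : A := (x ** y) ** z - x ** (y ** z).

Definition partially_alternative : Prop :=
  (exists q, imaginary_unit q) /\
  forall x y, imaginary_unit x ->
    [/\ associator x x y = 0, associator x y x = 0 & associator y x x = 0].

(* Preservation of the unit is automatic for a bijective multiplicative map. *)
Definition is_automorphism (f : 'End(A)) : Prop :=
  bijective f /\ {morph f : x y / x ** y >-> x ** y}.

Definition inner (f : A -> A) : Prop :=
  exists u v, [/\ u ** v = na_one A, v ** u = na_one A &
    forall x, f x = (u ** x) ** v /\ f x = u ** (x ** v)].

Record automorphism := Automorphism {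
  aut_lfun :> 'End(A);
  _ : `[< is_automorphism aut_lfun >] }.
HB.instance Definition _ := [isSub for aut_lfun].
HB.instance Definition _ := [Choice of automorphism by <:].

End Notions.

Definition alg_iso (F : fieldType) (A B : naAlgebra F) : Prop :=
  exists2 f : {linear A -> B},
    bijective f & {morph f : x y / x ** y >-> x ** y}.

Section AutGroup.
Variables (F : fieldType) (A : naAlgebra F).
Implicit Types f g : automorphism A.

Lemma aut_one_subproof : `[< is_automorphism (\1%VF : 'End(A)) >].
Proof.
apply/asboolP; split; first by exists id => x; rewrite id_lfunE.
by move=> x y; rewrite !id_lfunE.
Qed.

Lemma aut_mul_subproof f g :
  `[< is_automorphism (val f \o val g)%VF >].
Proof.
case: f g => [f /= /asboolP[bf mf]] [g /= /asboolP[bg mg]].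
apply/asboolP; split; last by move=> x y; rewrite !comp_lfunE mg mf.
by apply: (eq_bij (bij_comp bf bg)) => x; rewrite comp_lfunE.
Qed.

Lemma aut_lker0 f : lker (val f) == 0%VS.
Proof. by case: f => f /= /asboolP[bf _]; apply/lker0P; apply: bij_inj. Qed.

Lemma aut_valK f : cancel (val f) (val f)^-1%VF.
Proof. exact: lker0_lfunK (aut_lker0 f). Qed.

Lemma aut_valVK f : cancel (val f)^-1%VF (val f).
Proof.
move=> y; have fK := aut_valK f.
case: f fK => f /= /asboolP[[f' _ f'K] _] fK.
by rewrite -[y]f'K fK.
Qed.

Lemma aut_inv_subproof f : `[< is_automorphism ((val f)^-1)%VF >].
Proof.
apply/asboolP; split; first by exists (val f); [exact: aut_valVK|exact: aut_valK].
move=> x y; apply: (can_inj (aut_valK f)).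
have /asboolP[_ mf] := valP f.
by rewrite mf !aut_valVK.
Qed.

Definition aut_one : automorphism A := Automorphism aut_one_subproof.
Definition aut_mul f g : automorphism A := Automorphism (aut_mul_subproof f g).
Definition aut_inv f : automorphism A := Automorphism (aut_inv_subproof f).

Lemma aut_mulA : associative aut_mul.
Proof. by move=> f g k; apply: val_inj; rewrite /= comp_lfunA. Qed.
Lemma aut_mul1 : left_id aut_one aut_mul.
Proof. by move=> f; apply: val_inj; rewrite /= comp_lfun1l. Qed.
Lemma aut_mulr1 : right_id aut_one aut_mul.
Proof. by move=> f; apply: val_inj; rewrite /= comp_lfun1r. Qed.
Lemma aut_mulV : left_inverse aut_one aut_inv aut_mul.
Proof.
by move=> f; apply/val_inj/lfunP=> x; rewrite /= comp_lfunE id_lfunE aut_valK.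
Qed.
Lemma aut_mulrV : right_inverse aut_one aut_inv aut_mul.
Proof.
by move=> f; apply/val_inj/lfunP=> x; rewrite /= comp_lfunE id_lfunE aut_valVK.
Qed.

HB.instance Definition _ := isGroup.Build (automorphism A)
  aut_mulA aut_mul1 aut_mulr1 aut_mulV aut_mulrV.

End AutGroup.

Definition reflection (F : fieldType) (A : naAlgebra F) (f : automorphism A) : Prop :=
  f <> 1%g /\ (f ^+ 2 = 1)%g.

Definition group_iso (G H : groupType) : Prop :=
  exists f : {multiplicative G -> H}, bijective f.

Section SpecialOrthogonal.
Variables (F : fieldType) (n : nat).

Record SO := SpecialOrthogonal {
  SO_mx :> 'M[F]_n;
  _ : (SO_mx *m SO_mx^T == 1%:M) && (\det SO_mx == 1) }.
HB.instance Definition _ := [isSub for SO_mx].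
HB.instance Definition _ := [Choice of SO by <:].
Implicit Types M N : SO.

Lemma so_one_subproof :
  ((1%:M : 'M[F]_n) *m 1%:M^T == 1%:M) && (\det (1%:M : 'M[F]_n) == 1).
Proof. by rewrite trmx1 mulmx1 det1 !eqxx. Qed.

Lemma so_mul_subproof M N :
  ((val M *m val N) *m (val M *m val N)^T == 1%:M) &&
  (\det (val M *m val N) == 1).
Proof.
case: M N => [M /= /andP[/eqP M1 /eqP dM]] [N /= /andP[/eqP N1 /eqP dN]].
by rewrite trmx_mul mulmxA -(mulmxA M) N1 mulmx1 M1 det_mulmx dM dN mulr1 !eqxx.
Qed.

Lemma so_inv_subproof M :
  ((val M)^T *m (val M)^T^T == 1%:M) && (\det (val M)^T == 1).
Proof.
case: M => [M /= /andP[/eqP M1 /eqP dM]].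
by rewrite trmxK (mulmx1C M1) det_tr dM !eqxx.
Qed.

Definition so_one : SO := SpecialOrthogonal so_one_subproof.
Definition so_mul M N : SO := SpecialOrthogonal (so_mul_subproof M N).
Definition so_inv M : SO := SpecialOrthogonal (so_inv_subproof M).

Lemma so_mulA : associative so_mul.
Proof. by move=> M N P; apply: val_inj; rewrite /= mulmxA. Qed.
Lemma so_mul1 : left_id so_one so_mul.
Proof. by move=> M; apply: val_inj; rewrite /= mul1mx. Qed.
Lemma so_mulr1 : right_id so_one so_mul.
Proof. by move=> M; apply: val_inj; rewrite /= mulmx1. Qed.
Lemma so_mulrV : right_inverse so_one so_inv so_mul.
Proof. by case=> M MP; apply: val_inj; case/andP: (MP) => /eqP M1 _. Qed.
Lemma so_mulV : left_inverse so_one so_inv so_mul.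
Proof.
by case=> M MP; apply: val_inj; case/andP: (MP) => /eqP M1 _; apply: mulmx1C.
Qed.

HB.instance Definition _ := isGroup.Build SO
  so_mulA so_mul1 so_mulr1 so_mulV so_mulrV.

End SpecialOrthogonal.

(* The algebra on F^(n+1) with multiplication table t, whose unit is the first
   vector of the standard basis. *)
Section TableAlgebra.
Variables (F : fieldType) (n : nat) (t : 'I_n.+1 -> 'I_n.+1 -> 'rV[F]_n.+1).
Hypothesis t_1l : forall b, t 0 b = delta_mx 0 b.
Hypothesis t_1r : forall a, t a 0 = delta_mx 0 a.

Definition table_mul (x y : 'rV[F]_n.+1) : 'rV[F]_n.+1 :=
  \sum_a \sum_b (x 0 a * y 0 b) *: t a b.

Lemma table_mul_is_bilinear : bilinear_for *:%R *:%R table_mul.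
Proof.
split=> [y|x] c u v; rewrite /= /applyr_head /table_mul scaler_sumr -big_split /=;
apply: eq_bigr => a _; rewrite scaler_sumr -big_split /=;
by apply: eq_bigr => b _; rewrite scalerA -scalerDl !mxE !(mulrDl, mulrDr) mulrA
  // mulrCA mulrA.
Qed.

HB.instance Definition _ := bilinear_isBilinear.Build F
  'rV[F]_n.+1 'rV[F]_n.+1 'rV[F]_n.+1 *:%R *:%R table_mul
  table_mul_is_bilinear.

Lemma table_mul1l : left_id (delta_mx 0 0) table_mul.
Proof.
move=> y; rewrite /table_mul (bigD1 0) //= [X in _ + X]big1 ?addr0.
  rewrite [RHS]row_sum_delta; apply: eq_bigr => b _.
  by rewrite mxE !eqxx mul1r t_1l.
move=> a /negbTE a0; apply: big1 => b _.
by rewrite mxE a0 andbF mul0r scale0r.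
Qed.

Lemma table_mul1r : right_id (delta_mx 0 0) table_mul.
Proof.
move=> x; rewrite /table_mul [RHS]row_sum_delta; apply: eq_bigr => a _.
rewrite (bigD1 0) //= big1 ?addr0 ?mxE ?eqxx ?mulr1 ?t_1r //.
by move=> b /negbTE b0; rewrite mxE b0 andbF mulr0 scale0r.
Qed.

Definition table_algebra : naAlgebra F :=
  @NaAlgebra F 'rV[F]_n.+1 table_mul _ table_mul1l table_mul1r.

End TableAlgebra.

Section FourDimensional.
Variable F : fieldType.

Definition e1 : 'rV[F]_4 := delta_mx 0 0.
Definition ei : 'rV[F]_4 := delta_mx 0 1.
Definition ej : 'rV[F]_4 := delta_mx 0 2.
Definition ek : 'rV[F]_4 := delta_mx 0 3.

Definition table4 (s : seq (seq 'rV[F]_4)) (a b : 'I_4) : 'rV[F]_4 :=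
  nth 0 (nth [::] s a) b.

Definition Agh_table (g h : F) := table4
  [:: [:: e1;  ei;  ej;  ek ];
      [:: ei; -e1; -ek;  ej ];
      [:: ej;  ek; -e1; -ei ];
      [:: ek; -ej;  ei; g *: e1 + h *: ei ]].

Definition quaternion_table := table4
  [:: [:: e1;  ei;  ej;  ek ];
      [:: ei; -e1;  ek; -ej ];
      [:: ej; -ek; -e1;  ei ];
      [:: ek;  ej; -ei; -e1 ]].

Lemma Agh_table1l g h b : Agh_table g h 0 b = delta_mx 0 b.
Proof. by case: b => [[|[|[|[|//]]]] ?]; congr delta_mx; apply: val_inj. Qed.
Lemma Agh_table1r g h a : Agh_table g h a 0 = delta_mx 0 a.
Proof. by case: a => [[|[|[|[|//]]]] ?]; congr delta_mx; apply: val_inj. Qed.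
Lemma quaternion_table1l b : quaternion_table 0 b = delta_mx 0 b.
Proof. by case: b => [[|[|[|[|//]]]] ?]; congr delta_mx; apply: val_inj. Qed.
Lemma quaternion_table1r a : quaternion_table a 0 = delta_mx 0 a.
Proof. by case: a => [[|[|[|[|//]]]] ?]; congr delta_mx; apply: val_inj. Qed.

Definition Agh (g h : F) : naAlgebra F :=
  table_algebra (Agh_table1l g h) (Agh_table1r g h).

Definition quaternion : naAlgebra F :=
  table_algebra quaternion_table1l quaternion_table1r.

End FourDimensional.

(* Main.v *)
(* An imaginary unit of A_(g,h) has zero coordinate on 1, and when h <> 0 also
   on k.  Since k = j i, an automorphism f is determined by f i and f j, and
   when h <> 0 both lie in the plane of i and j; then f (k k) = g + h (f i)
   forces f i = i and f j = j or - j, and the nontrivial choice is conjugation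
   by i.

   When h = 0, having no zero divisors gives g < 0, so some multiple of k is an
   imaginary unit, and partial alternativity forces g = -1: the algebra is
   the opposite of the standard presentation of the quaternions.  The images of
   i, j, k are then the columns of a matrix of SO(3), and conversely the columns
   of a rotation satisfy the multiplication table because the adjugate of a
   rotation is its transpose (cross product relations).  Every automorphism f is
   inner because the averages u_c = \sum_b f(b) c b^-1, with b over 1, i, j, k,
   satisfy f(x) u_c = u_c x, and they do not all vanish since
   \sum_c u_c c^-1 = 4. *)

Require Import Defs.
From HB Require Import structures.
From mathcomp Require Import all_boot all_order all_fingroup all_algebra.
From mathcomp Require Import boolp reals ring lra.
Import Order.TTheory GRing.Theory Num.Theory.
Local Open Scope ring_scope.

Set Implicit Arguments.
Unset Strict Implicit.
Unset Printing Implicit Defensive.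

(** * Coordinates and product formulas in dimension four *)

Section Coordinates.
Variable F : fieldType.
Implicit Types (a b c d g h : F) (x y z : 'rV[F]_4).

Definition vec4 a b c d : 'rV[F]_4 := \row_(i < 4) [:: a; b; c; d]`_i.

Lemma rV4P x y :
  x 0 0 = y 0 0 -> x 0 1 = y 0 1 -> x 0 2 = y 0 2 -> x 0 3 = y 0 3 -> x = y.
Proof.
move=> E0 E1 E2 E3; apply/rowP; case=> -[|[|[|[|//]]]] lti.
- by rewrite (_ : Ordinal lti = 0) //; apply: val_inj.
- by rewrite (_ : Ordinal lti = 1) //; apply: val_inj.
- by rewrite (_ : Ordinal lti = 2) //; apply: val_inj.
- by rewrite (_ : Ordinal lti = 3) //; apply: val_inj.
Qed.

Lemma vec4_eta x : x = vec4 (x 0 0) (x 0 1) (x 0 2) (x 0 3).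
Proof. by apply: rV4P; rewrite !mxE. Qed.

Lemma vec4_inj a b c d a' b' c' d' :
  vec4 a b c d = vec4 a' b' c' d' -> [/\ a = a', b = b', c = c' & d = d'].
Proof.
by move=> /rowP E; move: (E 0) (E 1) (E 2) (E 3); rewrite !mxE.
Qed.

Lemma vec4D a b c d a' b' c' d' :
  vec4 a b c d + vec4 a' b' c' d' = vec4 (a + a') (b + b') (c + c') (d + d').
Proof. by apply: rV4P; rewrite !mxE. Qed.

Lemma vec4N a b c d : - vec4 a b c d = vec4 (- a) (- b) (- c) (- d).
Proof. by apply: rV4P; rewrite !mxE. Qed.

Lemma vec4Z s a b c d : s *: vec4 a b c d = vec4 (s * a) (s * b) (s * c) (s * d).
Proof. by apply: rV4P; rewrite !mxE. Qed.

Lemma e1E : e1 F = vec4 1 0 0 0. Proof. by apply: rV4P; rewrite !mxE. Qed.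
Lemma eiE : ei F = vec4 0 1 0 0. Proof. by apply: rV4P; rewrite !mxE. Qed.
Lemma ejE : ej F = vec4 0 0 1 0. Proof. by apply: rV4P; rewrite !mxE. Qed.
Lemma ekE : ek F = vec4 0 0 0 1. Proof. by apply: rV4P; rewrite !mxE. Qed.
Definition basisE := (e1E, eiE, ejE, ekE).

Lemma vec4_basis a b c d :
  vec4 a b c d = a *: e1 F + b *: ei F + c *: ej F + d *: ek F.
Proof. rewrite !basisE !vec4Z !vec4D; congr vec4; ring. Qed.

Lemma Agh_mulE g h a0 a1 a2 a3 b0 b1 b2 b3 :
  na_mul (Agh g h) (vec4 a0 a1 a2 a3) (vec4 b0 b1 b2 b3) =
  vec4 (a0 * b0 - a1 * b1 - a2 * b2 + g * (a3 * b3))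
       (a0 * b1 + a1 * b0 - a2 * b3 + a3 * b2 + h * (a3 * b3))
       (a0 * b2 + a2 * b0 + a1 * b3 - a3 * b1)
       (a0 * b3 + a3 * b0 - a1 * b2 + a2 * b1).
Proof.
rewrite /= /table_mul !big_ord_recl !big_ord0 /= /Agh_table /table4 /= !mxE /=.
rewrite !basisE !(vec4N, vec4Z, vec4D) !addr0.
rewrite !(vec4N, vec4Z, vec4D); congr vec4; ring.
Qed.

Lemma quaternion_mulE a0 a1 a2 a3 b0 b1 b2 b3 :
  na_mul (quaternion F) (vec4 a0 a1 a2 a3) (vec4 b0 b1 b2 b3) =
  vec4 (a0 * b0 - a1 * b1 - a2 * b2 - a3 * b3)
       (a0 * b1 + a1 * b0 + a2 * b3 - a3 * b2)
       (a0 * b2 + a2 * b0 - a1 * b3 + a3 * b1)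
       (a0 * b3 + a3 * b0 + a1 * b2 - a2 * b1).
Proof.
rewrite /= /table_mul !big_ord_recl !big_ord0 /= /quaternion_table /table4 /= !mxE /=.
rewrite !basisE !(vec4N, vec4Z, vec4D) !addr0.
rewrite !(vec4N, vec4Z, vec4D); congr vec4; ring.
Qed.

End Coordinates.

(** * Automorphisms of unital algebras, and a criterion for being inner *)

Section Automorphisms.
Variables (F : fieldType) (A : naAlgebra F).
Implicit Types f : automorphism A.

Lemma autM f : {morph f : x y / x ** y}.
Proof. by case: f => f /= /asboolP[]. Qed.

Lemma aut1 f : f (na_one A) = na_one A.
Proof.
(* The right factor of f(1) 1 is written as f(f^-1(1)), so that multiplicativity absorbs f(1). *)
by rewrite -[LHS]na_mul1r -{2}(aut_valVK f (na_one A)) -autM na_mul1l aut_valVK.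
Qed.

Lemma aut_imaginary_unit f (q : A) : imaginary_unit q -> imaginary_unit (f q).
Proof. by rewrite /imaginary_unit -autM => ->; rewrite linearN /= aut1. Qed.

Lemma division_mulI (x : A) :
  division_algebra A -> x != 0 -> injective (fun y => x ** y).
Proof. by move=> divA x0; have [/bij_inj] := divA x x0. Qed.

(** If f(x) = 0 with x nonzero, then x y = 1 has a solution and f(1) = f(x) f(y) = 0. Hence f is
    injective, and bijective by finite dimension. *)
Lemma division_is_automorphism (f : 'End(A)) :
  division_algebra A -> f (na_one A) != 0 ->
  {morph f : x y / x ** y >-> x ** y} -> is_automorphism f.
Proof.
move=> divA f1 fM; split=> //.
have ker0 : lker f == 0%VS.
  apply/lker0P/raddf_inj => x fx0; apply/eqP; apply: contraT => x0.
  have [[xi _ xiK] _] := divA x x0.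
  by move: f1; rewrite -(xiK (na_one A)) fM fx0 linear0l eqxx.
by exists (f^-1)%VF; [exact: lker0_lfunK|exact: lker0_lfunVK].
Qed.

(** A right inverse v of u is also a left inverse: u (v u) = u = u 1, and u cancels. Multiplying
    f(x) u = u x by v on the right then gives conjugation by u. *)
Lemma aut_inner f (u : A) :
  division_algebra A -> (forall x y z : A, associator x y z = 0) ->
  u != 0 -> (forall x, f x ** u = u ** x) -> inner f.
Proof.
move=> divA assocA u0 fu.
have mulA (x y z : A) : (x ** y) ** z = x ** (y ** z).
  exact: subr0_eq (assocA x y z).
have [[ui _ uiK] _] := divA u u0; set v := ui (na_one A).
have uv : u ** v = na_one A by exact: uiK.
exists u, v; split=> //; last by move=> x; rewrite -mulA -fu mulA uv na_mul1r.
by apply: (division_mulI divA u0); rewrite -mulA uv na_mul1l na_mul1r.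
Qed.

Lemma inner_id : inner (fun x : A => x).
Proof.
by exists (na_one A), (na_one A); split=> [||x]; rewrite ?na_mul1l ?na_mul1r.
Qed.

End Automorphisms.

(** * Homomorphisms out of a table algebra, and frames *)

Section TableMorphism.
Variables (F : fieldType) (n : nat) (t : 'I_n.+1 -> 'I_n.+1 -> 'rV[F]_n.+1).
Hypothesis t_1l : forall b, t 0 b = delta_mx 0 b.
Hypothesis t_1r : forall a, t a 0 = delta_mx 0 a.
Variable B : naAlgebra F.

Lemma table_algebra_morph (f : {linear 'rV[F]_n.+1 -> B}) :
  (forall a b, f (t a b) = f (delta_mx 0 a) ** f (delta_mx 0 b)) ->
  {morph f : x y / na_mul (table_algebra t_1l t_1r) x y >-> x ** y}.
Proof.
have fE z : f z = \sum_a z 0 a *: f (delta_mx 0 a).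
  by rewrite {1}[z]row_sum_delta linear_sum; apply: eq_bigr => a _; rewrite linearZ.
move=> ft x y; rewrite (fE x) (fE y) linear_sumlz /= /table_mul linear_sum.
apply: eq_bigr => a _; rewrite linear_sum linear_sumr; apply: eq_bigr => b _.
by rewrite linearZ /= linearZl_LR linearZr_LR /= scalerA ft.
Qed.

End TableMorphism.

Section Frames.
Variables (F : fieldType) (B : naAlgebra F).
Implicit Types p q r : B.

(** The ambient algebra is arbitrary: inside A_(g,h) frames describe automorphisms, and inside the
    quaternions a frame yields the isomorphism. *)
Definition Agh_frame g h p q r : Prop :=
  [/\ [/\ p ** p = - na_one B, p ** q = - r & p ** r = q],
      [/\ q ** p = r, q ** q = - na_one B & q ** r = - p] &
      [/\ r ** p = - q, r ** q = p & r ** r = g *: na_one B + h *: p]].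

Definition frame_map p q r (x : 'rV[F]_4) : B :=
  \sum_a x 0 a *: [:: na_one B; p; q; r]`_a.

Lemma frame_map_is_linear p q r : linear (frame_map p q r).
Proof.
move=> a x y; rewrite /frame_map scaler_sumr -big_split; apply: eq_bigr => b _.
by rewrite !mxE scalerDl scalerA.
Qed.

HB.instance Definition _ p q r := GRing.isLinear.Build F 'rV[F]_4 B *:%R
  (frame_map p q r) (frame_map_is_linear p q r).

Lemma frame_map_delta p q r a :
  frame_map p q r (delta_mx 0 a) = [:: na_one B; p; q; r]`_a.
Proof.
rewrite /frame_map (bigD1 a) //= big1 ?addr0 => [|b /negbTE ab].
  by rewrite mxE !eqxx scale1r.
by rewrite mxE ab andbF scale0r.
Qed.

Lemma frame_map_vec4 p q r a b c d :
  frame_map p q r (vec4 a b c d) = a *: na_one B + b *: p + c *: q + d *: r.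
Proof. by rewrite /frame_map !big_ord_recl big_ord0 !mxE addr0 !addrA. Qed.

Lemma Agh_frame_morph g h p q r : Agh_frame g h p q r ->
  {morph frame_map p q r : x y / na_mul (Agh g h) x y >-> x ** y}.
Proof.
move=> [[pp pq pr] [qp qq qr] [rp rq rr]]; apply: table_algebra_morph => a b.
case: a b => [[|[|[|[|//]]]] ?] [[|[|[|[|//]]]] ?];
  rewrite /Agh_table /table4 /= ?linearD ?linearN ?linearZ /= !frame_map_delta /=;
  by rewrite ?na_mul1l ?na_mul1r.
Qed.

End Frames.

Lemma aut_frame (F : fieldType) (B : naAlgebra F) (f : automorphism B) g h (p q r : B) :
  Agh_frame g h p q r -> Agh_frame g h (f p) (f q) (f r).
Proof.
move=> [[pp pq pr] [qp qq qr] [rp rq rr]].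
by split; split; rewrite -autM ?(pp, pq, pr, qp, qq, qr, rp, rq, rr)
  ?linearD ?linearN ?linearZ /= ?aut1.
Qed.

(** * Automorphisms of A_(g,h) read off from the images of i and j *)

Section AghAutomorphisms.
Variables (F : fieldType) (g h : F).
Local Notation A := (Agh g h).
Implicit Types f : automorphism A.

Lemma Agh_one : na_one A = vec4 1 0 0 0.
Proof. exact: e1E. Qed.

Lemma Agh_standard_frame : Agh_frame g h (ei F : A) (ej F : A) (ek F : A).
Proof.
split; split; rewrite ?Agh_one !basisE Agh_mulE ?(vec4N, vec4Z, vec4D);
  congr vec4; ring.
Qed.

Lemma aut_Agh_frame f : Agh_frame g h (f (ei F)) (f (ej F)) (f (ek F)).
Proof.
exact: aut_frame Agh_standard_frame.
Qed.

Lemma aut_frame_map f : f =1 frame_map (f (ei F)) (f (ej F)) (f (ek F)).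
Proof.
move=> x; rewrite [x in LHS]vec4_eta vec4_basis !linearD !linearZ /=.
by rewrite (aut1 f : f (e1 F) = _) {5}[x]vec4_eta frame_map_vec4.
Qed.

Lemma aut_Agh_ext f f' :
  f (ei F) = f' (ei F) -> f (ej F) = f' (ej F) -> f = f'.
Proof.
move=> Ei Ej; apply/val_inj/lfunP => x; rewrite [LHS]aut_frame_map [RHS]aut_frame_map.
have [_ [qp _ _] _] := aut_Agh_frame f; have [_ [qp' _ _] _] := aut_Agh_frame f'.
by rewrite -qp -qp' Ei Ej.
Qed.

End AghAutomorphisms.

Lemma group_iso_Z2 (G : groupType) (s : G) :
  s <> 1%g -> (s * s = 1)%g -> (forall x : G, x <> 1%g -> x = s) -> group_iso G 'Z_2.
Proof.
move=> /eqP s1 ss Gs.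
have GP x : x = 1%g \/ x = s by case: (eqVneq x 1%g) => [|/eqP /Gs]; [left|right].
(* The group law of ['Z_2] is addition, so [1%g] is the residue 0 and [inZp 1] is the generator. *)
pose phi (x : G) : 'Z_2 := if x == 1%g then 1%g else inZp 1.
have phiM : {morph phi : x y / (x * y)%g}.
  move=> x y; case: (GP x) => ->; case: (GP y) => ->;
    rewrite /phi ?ss ?mul1g ?mulg1 ?(negbTE s1) ?eqxx ?mul1g ?mulg1 //.
  by apply: val_inj.
pose phiH := isMultiplicative.Build G 'Z_2 phi phiM.
pose phi' : {multiplicative G -> 'Z_2} := HB.pack phi phiH.
exists phi'.
exists (fun z : 'Z_2 => if z == 1%g then 1%g else s).
  by move=> x; case: (GP x) => ->; rewrite /= /phi ?(negbTE s1) ?eqxx.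
by case=> -[|[|//]] lti; rewrite /= /phi ?(negbTE s1) ?eqxx; apply: val_inj.
Qed.

(** * Imaginary units over an ordered field, and automorphisms for h <> 0 *)

Section RealFrames.
Variables (F : realFieldType) (g h : F).
Local Notation A := (Agh g h).
Implicit Types f : automorphism A.

(** If a were nonzero, the j and k coordinates 2ac and 2ad of the square would force c = d = 0, then
    the i coordinate b = 0, leaving a^2 = -1 in an ordered field. *)
Lemma Agh_imaginary_unit a b c d :
  @imaginary_unit F A (vec4 a b c d) ->
  [/\ a = 0, b ^+ 2 + c ^+ 2 - g * d ^+ 2 = 1 & h * d ^+ 2 = 0].
Proof.
rewrite /imaginary_unit Agh_one Agh_mulE vec4N => /vec4_inj[E0 E1 E2 E3].
have a0 : a = 0.
  apply/eqP; apply: contraT => an0.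
  have c0 : c = 0 by apply: (mulfI an0); lra.
  have d0 : d = 0 by apply: (mulfI an0); lra.
  have b0 : b = 0 by apply: (mulfI an0); move: E1; rewrite c0 d0; lra.
  by move: E0 (sqr_ge0 a); rewrite b0 c0 d0; lra.
by split=> //; move: E0 E1; rewrite a0; lra.
Qed.

Lemma Agh_aut_imag f q : @imaginary_unit F A q ->
  exists a b c, [/\ f q = vec4 0 a b c, a ^+ 2 + b ^+ 2 - g * c ^+ 2 = 1 &
                    h * c ^+ 2 = 0].
Proof.
move=> /(aut_imaginary_unit f); rewrite [f q]vec4_eta => /Agh_imaginary_unit.
by move=> [-> ? ?]; do 3!eexists; split; first reflexivity.
Qed.

Lemma ei_unit : @imaginary_unit F A (ei F).
Proof. by have [[]] := Agh_standard_frame g h. Qed.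
Lemma ej_unit : @imaginary_unit F A (ej F).
Proof. by have [_ []] := Agh_standard_frame g h. Qed.

Lemma Agh_aut_cases f : h != 0 ->
  f (ei F) = ei F /\ (f (ej F) = ej F \/ f (ej F) = - ej F).
Proof.
move=> h0; have [[_ pq _] [qp _ _] [_ _ rr]] := aut_Agh_frame f.
have [a [b [c [fi ab hc]]]] := Agh_aut_imag f ei_unit.
have [a' [b' [c' [fj ab' hc']]]] := Agh_aut_imag f ej_unit.
have {hc}c0 : c = 0 by move/eqP: hc; rewrite mulf_eq0 (negbTE h0) sqrf_eq0 => /eqP.
have {hc'}c'0 : c' = 0 by move/eqP: hc'; rewrite mulf_eq0 (negbTE h0) sqrf_eq0 => /eqP.
subst c c'.
move: qp pq rr; rewrite fi fj !Agh_mulE => <-.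
rewrite Agh_mulE Agh_one vec4N !vec4Z vec4D.
move=> /vec4_inj[E1 _ _ _] /vec4_inj[_ E2 E3 _].
(* By [E1], f k = f j f i has no scalar part and equals d k with d = b' a - a' b. Comparing h d^2 i
   with h (a i + b j) in the image of k k gives b = 0 and a = d^2. *)
have b0 : b = 0 by apply: (mulfI h0); lra.
have aE : a = (b' * a) ^+ 2 by apply: (mulfI h0); rewrite b0 in E2; lra.
have {aE}a1 : a = 1.
  (* Being a square rules out the root -1 of a^2 = 1. *)
  have : 0 <= a by rewrite aE sqr_ge0.
  by move: ab; rewrite b0; nra.
subst a b; have a'0 : a' = 0 by lra.
subst a'; split; first by rewrite eiE.
have : (b' - 1) * (b' + 1) = 0 by lra.
move/eqP; rewrite mulf_eq0 => /orP[]/eqP b'E; [left|right];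
  rewrite ejE ?vec4N; congr vec4; lra.
Qed.

End RealFrames.

(** * Automorphisms built from frames, and the reflection fixing i *)

Section FrameAutomorphism.
Variables (F : fieldType) (g h : F).
Local Notation A := (Agh g h).
Variables (p q r : A).
Hypotheses (divA : division_algebra A) (pqr : Agh_frame g h p q r).

Lemma frame_aut_subproof :
  `[< @is_automorphism F A (linfun (frame_map p q r)) >].
Proof.
apply/asboolP/division_is_automorphism => //.
  rewrite lfunE /= frame_map_delta /=.
  by apply/eqP=> /rowP/(_ 0)/eqP; rewrite !mxE oner_eq0.
by move=> x y; rewrite !lfunE; exact: (Agh_frame_morph pqr).
Qed.

Definition frame_automorphism : automorphism A := Automorphism frame_aut_subproof.

Lemma frame_automorphismE x : frame_automorphism x = frame_map p q r x.
Proof. by rewrite lfunE. Qed.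

Lemma frame_automorphism_delta a :
  frame_automorphism (delta_mx 0 a) = [:: na_one A; p; q; r]`_a.
Proof. by rewrite frame_automorphismE frame_map_delta. Qed.

End FrameAutomorphism.

Section NonQuaternion.
Variables (F : realFieldType) (g h : F).
Hypothesis divA : division_algebra (Agh g h).
Local Notation A := (Agh g h).

Lemma reflected_frame : Agh_frame g h (ei F : A) (- ej F : A) (- ek F : A).
Proof.
have [[pp pq pr] [qp qq qr] [rp rq rr]] := Agh_standard_frame g h.
by split; split; rewrite ?linearNl ?linearNr /= ?opprK
  ?(pp, pq, pr, qp, qq, qr, rp, rq, rr) ?opprK.
Qed.

Definition Agh_reflection : automorphism A := frame_automorphism divA reflected_frame.

Lemma Agh_reflectionE a b c d :
  Agh_reflection (vec4 a b c d) = vec4 a b (- c) (- d).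
Proof.
rewrite frame_automorphismE frame_map_vec4 Agh_one !basisE !(vec4N, vec4Z, vec4D).
congr vec4; ring.
Qed.

Lemma Agh_reflection_neq1 : Agh_reflection <> 1%g.
Proof.
move=> /(congr1 (fun f : automorphism A => f (ej F))).
rewrite ejE Agh_reflectionE id_lfunE => /vec4_inj[_ _ E _]; lra.
Qed.

Lemma Agh_reflection_mul : (Agh_reflection * Agh_reflection = 1)%g.
Proof.
apply/val_inj/lfunP => x; rewrite comp_lfunE id_lfunE [x]vec4_eta.
by rewrite !Agh_reflectionE !opprK.
Qed.

Lemma Agh_reflection_inner : inner Agh_reflection.
Proof.
exists (ei F), (- ei F); have [[ii _ _] _ _] := Agh_standard_frame g h.
split; rewrite ?linearNl ?linearNr /= ?ii ?opprK //.
move=> x; rewrite [x]vec4_eta Agh_reflectionE !basisE !(vec4N, Agh_mulE).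
by split; congr vec4; ring.
Qed.

Lemma Agh_aut_reflection (f : automorphism A) :
  h != 0 -> f <> 1%g -> f = Agh_reflection.
Proof.
move=> h0 f1; have [fi [fj|fj]] := Agh_aut_cases f h0.
  by case: f1; apply: aut_Agh_ext; rewrite ?fi ?fj id_lfunE.
by apply: aut_Agh_ext; rewrite ?fi ?fj frame_automorphism_delta.
Qed.

End NonQuaternion.

(** * Rotation matrices and cross products *)

Section Matrix3.
Variable F : realFieldType.

Definition mat3 a1 b1 c1 a2 b2 c2 a3 b3 c3 : 'M[F]_3 :=
  \matrix_(i, j)
    (nth [::] [:: [:: a1; b1; c1]; [:: a2; b2; c2]; [:: a3; b3; c3]] i)`_j.

Lemma mx33P (M N : 'M[F]_3) :
  [/\ M 0 0 = N 0 0, M 0 1 = N 0 1 & M 0 2 = N 0 2] ->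
  [/\ M 1 0 = N 1 0, M 1 1 = N 1 1 & M 1 2 = N 1 2] ->
  [/\ M 2 0 = N 2 0, M 2 1 = N 2 1 & M 2 2 = N 2 2] -> M = N.
Proof.
have ord3 (i : 'I_3) : [\/ i = 0, i = 1 | i = 2].
  by case: i => -[|[|[|//]]] lti; [apply: Or31|apply: Or32|apply: Or33];
    apply: val_inj.
move=> [? ? ?] [? ? ?] [? ? ?]; apply/matrixP => i j.
by case: (ord3 i) => ->; case: (ord3 j) => ->.
Qed.

Lemma mat3_eta (M : 'M[F]_3) :
  M = mat3 (M 0 0) (M 0 1) (M 0 2) (M 1 0) (M 1 1) (M 1 2) (M 2 0) (M 2 1) (M 2 2).
Proof. by apply: mx33P; rewrite !mxE. Qed.

Lemma mat3_eq1 a1 b1 c1 a2 b2 c2 a3 b3 c3 :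
  mat3 a1 b1 c1 a2 b2 c2 a3 b3 c3 = 1%:M ->
  [/\ [/\ a1 = 1, b1 = 0 & c1 = 0], [/\ a2 = 0, b2 = 1 & c2 = 0] &
      [/\ a3 = 0, b3 = 0 & c3 = 1]].
Proof.
move/matrixP=> E.
by split; split; [have := E 0 0|have := E 0 1|have := E 0 2|have := E 1 0
  |have := E 1 1|have := E 1 2|have := E 2 0|have := E 2 1|have := E 2 2]; rewrite !mxE.
Qed.

Section Entries.
Variables a1 b1 c1 a2 b2 c2 a3 b3 c3 : F.
Local Notation M := (mat3 a1 b1 c1 a2 b2 c2 a3 b3 c3).

Lemma tr_mat3 : M^T = mat3 a1 a2 a3 b1 b2 b3 c1 c2 c3.
Proof. by apply: mx33P; rewrite !mxE. Qed.

Lemma gram_mat3 : M^T *m M =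
  mat3 (a1 * a1 + a2 * a2 + a3 * a3) (a1 * b1 + a2 * b2 + a3 * b3)
       (a1 * c1 + a2 * c2 + a3 * c3) (b1 * a1 + b2 * a2 + b3 * a3)
       (b1 * b1 + b2 * b2 + b3 * b3) (b1 * c1 + b2 * c2 + b3 * c3)
       (c1 * a1 + c2 * a2 + c3 * a3) (c1 * b1 + c2 * b2 + c3 * b3)
       (c1 * c1 + c2 * c2 + c3 * c3).
Proof.
by apply: mx33P; rewrite !mxE !big_ord_recl !big_ord0 !mxE /= !addr0 !addrA.
Qed.

(** The triple product (a x b) . c of the columns: the form into which the relation p q = -r
    substitutes directly. *)
Lemma det_mat3 : \det M =
  (a2 * b3 - a3 * b2) * c1 + (a3 * b1 - a1 * b3) * c2 + (a1 * b2 - a2 * b1) * c3.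
Proof.
rewrite (expand_det_row _ 0) !big_ord_recl big_ord0 /cofactor /= !mxE /=.
rewrite !(expand_det_row _ 0) !big_ord_recl !big_ord0 /cofactor /= !det_mx11 !mxE /=.
ring.
Qed.

(** The rows are the cross products b x c, c x a and a x b of the columns, so adj M = M^T encodes
    the vector parts of the frame relations. *)
Lemma adj_mat3 : \adj M =
  mat3 (b2 * c3 - b3 * c2) (b3 * c1 - b1 * c3) (b1 * c2 - b2 * c1)
       (c2 * a3 - c3 * a2) (c3 * a1 - c1 * a3) (c1 * a2 - c2 * a1)
       (a2 * b3 - a3 * b2) (a3 * b1 - a1 * b3) (a1 * b2 - a2 * b1).
Proof.
apply: mx33P; split; rewrite !mxE /cofactor (expand_det_row _ 0) !big_ord_recl
    big_ord0;
  rewrite /cofactor !det_mx11 !mxE /=; ring.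
Qed.

Lemma SO3_frameP :
  (M *m M^T == 1%:M) && (\det M == 1) <->
  @Agh_frame F (Agh (-1) 0) (-1) 0
    (vec4 0 a1 a2 a3) (vec4 0 b1 b2 b3) (vec4 0 c1 c2 c3).
Proof.
split=> [/andP[/eqP MMT /eqP dM]|].
  have MTM := mulmx1C MMT.
  have : \adj M = M^T.
    by rewrite -[LHS]mul1mx -MTM -mulmxA mul_mx_adj dM mulmx1.
  rewrite adj_mat3 tr_mat3 => /matrixP E.
  move: (E 0 0) (E 0 1) (E 0 2) (E 1 0) (E 1 1) (E 1 2) (E 2 0) (E 2 1) (E 2 2).
  rewrite !mxE /= => {E} *.
  move: MTM; rewrite gram_mat3.
  move=> /mat3_eq1[[? ? ?] [? ? ?] [? ? ?]].
  split; split; rewrite Agh_mulE ?Agh_one ?(vec4N, vec4Z, vec4D); congr vec4; lra.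
move=> [[pp pq pr] [qp qq qr] [rp rq rr]].
move: pp pq pr qq qr rr qp rp rq; rewrite !Agh_mulE ?Agh_one !(vec4N, vec4Z, vec4D).
move=> /vec4_inj[pp _ _ _] /vec4_inj[pq p1 p2 p3].
move=> /vec4_inj[pr _ _ _] /vec4_inj[qq _ _ _].
move=> /vec4_inj[qr _ _ _] /vec4_inj[rr _ _ _] _ _ _.
(* The scalar parts of the products are minus the inner products of the columns. *)
have MTM : M^T *m M = 1%:M.
  rewrite gram_mat3; apply: mx33P; split; rewrite !mxE /=; lra.
rewrite (mulmx1C MTM) eqxx det_mat3 /=; apply/eqP.
(* The vector part of p q = -r says a x b = c, so the determinant becomes c . c = 1; this excludes
   determinant -1. *)
have -> : a2 * b3 - a3 * b2 = c1 by lra.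
have -> : a3 * b1 - a1 * b3 = c2 by lra.
have -> : a1 * b2 - a2 * b1 = c3 by lra.
lra.
Qed.
End Entries.

End Matrix3.

(** * Intertwiners from averaging over the quaternion group *)

Section Average.
Variables (F : fieldType) (B : naAlgebra F) (i j k p q r : B).
Hypothesis assocB : forall x y z : B, associator x y z = 0.
Hypotheses (ijk : Agh_frame (-1) 0 i j k) (pqr : Agh_frame (-1) 0 p q r).

(** With f(i), f(j), f(k) = p, q, r, the elements b and -b give the same term f(b) c b^-1, so this
    is half the sum over the group of order 8. The minus signs come from b^-1 = -b for b = i, j,
    k. *)
Definition Q8_average (c : B) : B :=
  c - (p ** c) ** i - (q ** c) ** j - (r ** c) ** k.

(** Replacing b by i b permutes 1, i, j, k up to sign, hence permutes the terms of the average u;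
    this gives p u i^-1 = u. The same holds for j, and the relation for k follows from r = q p and k
    = j i. *)
Lemma Q8_average_intertwines_units c :
  [/\ p ** Q8_average c = Q8_average c ** i, q ** Q8_average c = Q8_average c ** j &
      r ** Q8_average c = Q8_average c ** k].
Proof.
have mulA (x y z : B) : (x ** y) ** z = x ** (y ** z) := subr0_eq (assocB x y z).
have mulNl (x y : B) : (- x) ** y = - (x ** y) by exact: linearNl.
have mulNr (x y : B) : x ** (- y) = - (x ** y) by exact: linearNr.
have [[pp pq pr] [qp qq qr] _] := pqr.
have [[ii ij ik] [ji jj jk] [ki kj _]] := ijk.
have pu : p ** Q8_average c = Q8_average c ** i.
  rewrite /Q8_average !(linearBl, linearBr) /= !mulA ii ji ki -![p ** (_ ** (_ ** _))]mulA.
  rewrite pp pq pr !(mulNl, mulNr, na_mul1l, na_mul1r) !opprK.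
  by rewrite addrAC (addrC (p ** c)).
have qu : q ** Q8_average c = Q8_average c ** j.
  rewrite /Q8_average !(linearBl, linearBr) /= !mulA ij jj kj -![q ** (_ ** (_ ** _))]mulA.
  rewrite qp qq qr !(mulNl, mulNr, na_mul1l, na_mul1r) !opprK.
  by rewrite -[LHS]addrA [LHS]addrC addrA.
by split=> //; rewrite -qp -ji mulA pu -[RHS]mulA -qu mulA.
Qed.

Lemma Q8_average_intertwines c x :
  frame_map p q r x ** Q8_average c = Q8_average c ** frame_map i j k x.
Proof.
have := Q8_average_intertwines_units c; move: (Q8_average c) => u [pu qu ru].
rewrite [x]vec4_eta !frame_map_vec4 !(linearDl, linearDr) /=.
by rewrite !linearZl_LR !linearZr_LR /= na_mul1l na_mul1r pu qu ru.
Qed.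

End Average.

(** * The case g = -1, h = 0: quaternions and SO(3) *)

Section Quaternion.
Variable F : realFieldType.
Local Notation A := (Agh (-1 : F) 0).
Implicit Types f : automorphism A.

Lemma Agh_assoc (x y z : A) : associator x y z = 0.
Proof.
rewrite /associator [x]vec4_eta [y]vec4_eta [z]vec4_eta !Agh_mulE vec4N vec4D.
by apply: rV4P; rewrite !mxE /=; ring.
Qed.

Lemma Agh_iso_quaternion : alg_iso A (quaternion F).
Proof.
(* In A_(-1,0) one has j i = k, but j i = -k in the quaternions, hence the sign on k. *)
pose psi := frame_map (ei F : quaternion F) (ej F) (- ek F).
exists psi; last first.
  apply: Agh_frame_morph.
  by split; split; rewrite ?[na_one _]e1E !basisE ?vec4N quaternion_mulE
    ?(vec4N, vec4Z, vec4D); congr vec4; ring.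
have psiE a b c d : psi (vec4 a b c d) = vec4 a b c (- d).
  rewrite /psi /= frame_map_vec4 [na_one _]e1E !basisE !(vec4N, vec4Z, vec4D).
  by congr vec4; ring.
have psiK : cancel psi psi by move=> x; rewrite [x]vec4_eta !psiE opprK.
by exists psi.
Qed.

(** For g = -1 and h = 0, k is an imaginary unit like i and j; automorphisms preserve such units,
    and these have no scalar part. *)
Lemma aut_scalar_part f a : f (delta_mx 0 (lift 0 a)) 0 0 = 0.
Proof.
have [[ii _ _] [_ jj _] [_ _ kk]] := Agh_standard_frame (-1 : F) 0.
suff /(Agh_aut_imag f)[x [y [z [-> _ _]]]] :
  @imaginary_unit F A (delta_mx 0 (lift 0 a)) by rewrite mxE.
case: a => -[|[|[|//]]] lti.
- by rewrite (_ : lift _ _ = 1) //; apply: val_inj.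
- by rewrite (_ : lift _ _ = 2) //; apply: val_inj.
rewrite (_ : lift _ _ = 3); last exact: val_inj.
by rewrite /imaginary_unit [LHS]kk scale0r addr0 scaleN1r.
Qed.

(** [lift 0] skips the coordinate along 1. Images are placed in columns so that composition becomes
    the matrix product in the same order. *)
Definition aut_mx f : 'M[F]_3 := \matrix_(i, j) f (delta_mx 0 (lift 0 j)) 0 (lift 0 i).

Lemma aut_mxE f : f =1 frame_map
  (vec4 0 (aut_mx f 0 0) (aut_mx f 1 0) (aut_mx f 2 0) : A)
  (vec4 0 (aut_mx f 0 1) (aut_mx f 1 1) (aut_mx f 2 1))
  (vec4 0 (aut_mx f 0 2) (aut_mx f 1 2) (aut_mx f 2 2)).
Proof.
have l0 : lift (0 : 'I_4) (0 : 'I_3) = 1 by apply: val_inj.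
have l1 : lift (0 : 'I_4) (1 : 'I_3) = 2 by apply: val_inj.
have l2 : lift (0 : 'I_4) (2 : 'I_3) = 3 by apply: val_inj.
have col a : f (delta_mx 0 (lift 0 a)) = vec4 0 (aut_mx f 0 a) (aut_mx f 1 a) (aut_mx f 2 a).
  by apply: rV4P; rewrite ?aut_scalar_part !mxE /= ?l0 ?l1 ?l2.
by rewrite -!col l0 l1 l2; exact: aut_frame_map.
Qed.

Lemma aut_mx_subproof f : (aut_mx f *m (aut_mx f)^T == 1%:M) && (\det (aut_mx f) == 1).
Proof.
rewrite [aut_mx f]mat3_eta; apply/SO3_frameP.
have := aut_Agh_frame f.
by rewrite !aut_mxE /ei /ej /ek !frame_map_delta.
Qed.

Definition aut_SO f : SO F 3 := SpecialOrthogonal (aut_mx_subproof f).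

Lemma aut_SO_morph : {morph aut_SO : f f' / (f * f')%g}.
Proof.
move=> f f'; apply/val_inj/matrixP => i j; rewrite !mxE comp_lfunE.
(* The summand along 1 vanishes, leaving the three terms of a matrix product entry. *)
rewrite [f' _]row_sum_delta big_ord_recl aut_scalar_part scale0r add0r.
rewrite linear_sum summxE.
by apply: eq_bigr => a _; rewrite linearZ !mxE mulrC.
Qed.

HB.instance Definition _ :=
  isMultiplicative.Build (automorphism A) (SO F 3) aut_SO aut_SO_morph.

Lemma aut_SO_inj : injective aut_SO.
Proof.
move=> f f' /(congr1 val) /= E; apply/val_inj/lfunP => x.
by rewrite [LHS]aut_mxE [RHS]aut_mxE E.
Qed.

Hypothesis divA : division_algebra A.

Lemma aut_SO_surj (M : SO F 3) : exists f, aut_SO f = M.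
Proof.
case: M => M MP; have fr := MP; rewrite [M]mat3_eta in fr; move/SO3_frameP: fr => fr.
exists (frame_automorphism divA fr); apply: val_inj; rewrite /= [RHS]mat3_eta.
by apply: mx33P; split; rewrite !mxE frame_automorphism_delta /= !mxE.
Qed.

Lemma Agh_aut_group_iso : group_iso (automorphism A) (SO F 3).
Proof.
exists aut_SO.
have [inv invK] := choice aut_SO_surj.
by exists inv => // f; apply: aut_SO_inj; rewrite invK.
Qed.

(** For fixed b among 1, i, j, k, the sum of c b^-1 c^-1 over c among 1, i, j, k is 4 if b = 1;
    otherwise it is 0, since exactly two of the c anticommute with b. Hence p, q, r cancel from the
    sum of the u(c) c^-1, whatever they are. *)
Lemma Q8_average_neq0 (p q r : A) :
  exists c, Q8_average (ei F : A) (ej F : A) (ek F : A) p q r c != 0.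
Proof.
set u := Q8_average _ _ _ _ _ _; apply: contrapT => /forallNP E.
have {}E c : u c = 0 by apply: contrapT => /eqP/E.
have : u (e1 F) - u (ei F) ** (ei F : A) - u (ej F) ** (ej F : A)
    - u (ek F) ** (ek F : A) = 4 *: e1 F.
  rewrite /u /Q8_average [p]vec4_eta [q]vec4_eta [r]vec4_eta !basisE.
  by rewrite !(Agh_mulE, vec4N, vec4D) vec4Z; congr vec4; ring.
rewrite !E !linear0l !subr0 => /esym/eqP; rewrite scaler_eq0 pnatr_eq0 /=.
by move=> /eqP/rowP/(_ 0)/eqP; rewrite !mxE oner_eq0.
Qed.

Lemma Agh_aut_inner f : inner f.
Proof.
have [c u0] := Q8_average_neq0 (f (ei F)) (f (ej F)) (f (ek F)).
apply: (aut_inner divA Agh_assoc u0) => x.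
have := Q8_average_intertwines Agh_assoc (Agh_standard_frame (-1) 0)
  (aut_Agh_frame f) c x.
rewrite -aut_frame_map => ->; congr (_ ** _).
by rewrite [RHS]vec4_eta vec4_basis [x in LHS]vec4_eta frame_map_vec4.
Qed.

End Quaternion.

(** * Reduction to g = -1 when h = 0, and the theorem *)

Lemma Agh_quaternion_parameter (R : rcfType) (g : R) :
  division_algebra (Agh g 0) -> partially_alternative (Agh g 0) -> g = -1.
Proof.
move=> divA [_ altA].
have g0 : g < 0.
  rewrite ltNge; apply/negP => g0; set s := Num.sqrt g.
  have sE : s ^+ 2 = g by rewrite sqr_sqrtr.
  have nz (t : R) : vec4 t 0 0 1 != 0.
    by apply/eqP => /rowP/(_ 3)/eqP; rewrite !mxE oner_eq0.
  (* Since k^2 = g when h = 0, the product (s + k)(-s + k) = g - s^2 vanishes although neither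
     factor does. *)
  have : na_mul (Agh g 0) (vec4 s 0 0 1) (vec4 (- s) 0 0 1) = 0.
    by rewrite Agh_mulE; apply: rV4P; rewrite !mxE /=; lra.
  move=> E; case/eqP: (nz (- s)); apply: (division_mulI divA (nz s)).
  by rewrite /= [LHS]E [RHS]linear0r.
(* The scaling that makes (t k)^2 = t^2 g equal to -1. *)
pose t := (Num.sqrt (- g))^-1.
have tE : t ^+ 2 * g = - 1.
  rewrite exprVn sqr_sqrtr; last by lra.
  by field; lra.
have /(altA _ (ei R)) [] : @imaginary_unit R (Agh g 0) (vec4 0 0 0 t).
  rewrite /imaginary_unit Agh_one Agh_mulE vec4N; congr vec4; lra.
rewrite /associator !basisE !Agh_mulE vec4N vec4D.
move=> /rowP/(_ 1); rewrite !mxE /= => E _ _.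
(* For x = t k, (x x) i = -i while x (x i) = -t^2 (k j) = -t^2 i. *)
have t2 : t ^+ 2 = 1 by lra.
by move: tE; rewrite t2 mul1r.
Qed.

Theorem theorem4 (R : realType) (g h : R) :
  division_algebra (Agh g h) ->
  partially_alternative (Agh g h) ->
  (forall f : automorphism (Agh g h), inner f) /\
  (h = 0 ->
     alg_iso (Agh g h) (quaternion R) /\
     group_iso (automorphism (Agh g h)) (SO R 3)) /\
  (h <> 0 ->
     group_iso (automorphism (Agh g h)) 'Z_2 /\
     exists r : automorphism (Agh g h),
       reflection r /\ forall f : automorphism (Agh g h), f <> 1%g -> f = r).
Proof.
move=> divA altA; have [h0|h0] := eqVneq h 0.
  subst h; have g1 := Agh_quaternion_parameter divA altA; subst g.
  split; first exact: Agh_aut_inner.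
  by split=> // _; split; [exact: Agh_iso_quaternion|exact: Agh_aut_group_iso].
have refl_neq1 := @Agh_reflection_neq1 _ _ _ divA.
have refl_mul := @Agh_reflection_mul _ _ _ divA.
have refl_only f := @Agh_aut_reflection _ _ _ divA f h0.
split.
  move=> f; have [->|/eqP/refl_only->] := eqVneq f 1%g; last first.
    exact: Agh_reflection_inner.
  have [u [v [uv vu E]]] := inner_id (Agh g h).
  by exists u, v; split=> // x; rewrite id_lfunE; apply: E.
split=> [/eqP|_]; first by rewrite (negbTE h0).
split; first exact: group_iso_Z2 refl_neq1 refl_mul refl_only.
by exists (Agh_reflection divA); split=> //; split=> //; rewrite expgS expg1.
Qed.
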